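(* For solutions $u$ of the scalar problem $$\partial_tu+\partial_x^3u+b(x)\partial_x^2u=f,\qquad u(x,0)=u_0(x),\qquad x\in\mathbb R,$$ the condition on the coefficient $b$ $$\sup_{(x,t,r)}\int_0^tb(x+r s)\,r\,ds<\infty$$ is necessary for the $L^2$ estimate $$\|u\|_{L^\infty_IL^2_x}\le A\big(\|u_0\|_{L^2}+\|f\|_{L^1_IL^2_x}\big).$$
   Context: All functions are real valued, and the supremum is over real $x,t,r$. The coefficient $b$ is $C^2$ and bounded together with its derivatives up to order 2. $\|f\|_{L^1_IL^2_x}=\int_I\|f(t)\|_{L^2_x}dt$, and $I$ is a time interval containing $0$. The estimate is understood as follows: there are constants $A$ and $T>0$, depending only on the coefficient $b$, such that the inequality holds for every classical solution $u$ on every interval $I=[0,T']$, $[-T',0]$ or $[-T',T']$ with $0<T'\le T$. *)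

(* Defs.v *)
(* Library: MathComp-Analysis, over an arbitrary R : realType. *)
From mathcomp Require Import all_boot all_order all_algebra.
From mathcomp Require Import all_classical all_reals all_analysis.

Set Implicit Arguments.
Unset Strict Implicit.
Unset Printing Implicit Defensive.

Import Order.TTheory GRing.Theory Num.Theory.
Import numFieldNormedType.Exports.

Local Open Scope classical_set_scope.
Local Open Scope ring_scope.

Definition C2_bounded (R : realType) (b : R -> R) : Prop :=
  [/\ forall k, (k < 2)%N -> forall x, derivable (b^`(k))%classic x 1,
      continuous (b^`(2))%classic &
      forall k, (k <= 2)%N -> exists M : R, forall x,
        `|(b^`(k))%classic x| <= M].

(* \int_0^t g, with the usual sign convention when t < 0 (the integral over a
   set is not oriented). *)
Definition integral_from0 (R : realType) (t : R) (g : R -> R) : R :=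
  if 0 <= t then (\int[@lebesgue_measure R]_(s in `[0, t]) g s)%R
  else - (\int[@lebesgue_measure R]_(s in `[t, 0]) g s)%R.

(* g is differentiable at t relative to the set I, with derivative l: on a
   closed interval this is the one-sided derivative at the endpoints. *)
Definition is_derive_within (R : realType) (I : set R) (g : R -> R) (t l : R) :
    Prop :=
  ((g s - g t) / (s - t)) @[s --> within I t^'] --> l.

(* Functions of space and time are written u x t, so u ^~ t is the space
   profile at time t and u x the time profile at x. *)
Definition dx (R : realType) (k : nat) (u : R -> R -> R) (x t : R) : R :=
  ((u ^~ t)^`(k))%classic x.

(* Only the values of u and f on R x I matter. *)
Definition classical_solution (R : realType) (b : R -> R) (I : set R)
    (f : R -> R -> R) (u0 : R -> R) (u : R -> R -> R) : Prop :=
  exists ut : R -> R -> R,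
    [/\ (forall k, (k < 3)%N -> forall t, I t -> forall x,
           derivable (dx k u ^~ t) x 1) /\
        (forall k, (k <= 3)%N ->
           {within [set: R] `*` I,
             continuous (fun z : R * R => dx k u z.1 z.2)}),
        forall x t, I t -> is_derive_within I (u x) t (ut x t),
        {within [set: R] `*` I, continuous (fun z : R * R => ut z.1 z.2)},
        forall x t, I t ->
          ut x t + dx 3 u x t + b x * dx 2 u x t = f x t &
        forall x, u x 0 = u0 x].

Definition L2norm (R : realType) (g : R -> R) : \bar R :=
  'N[@lebesgue_measure R]_(2%:E)[EFin \o g].

(* Extending by 0 outside I does not change the essential supremum over I,
   since the norms are nonnegative. *)
Definition LinftyL2norm (R : realType) (I : set R) (u : R -> R -> R) : \bar R :=
  'N[@lebesgue_measure R]_(+oo%E)[(fun t => L2norm (u ^~ t)) \_ I].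

Definition L1L2norm (R : realType) (I : set R) (f : R -> R -> R) : \bar R :=
  (\int[@lebesgue_measure R]_(t in I) L2norm (f ^~ t))%E.

(* The solutions are taken in L^oo_I L^2_x, i.e. the left-hand side of the
   estimate is finite.  Without any condition at spatial infinity there are
   nonzero classical solutions with f = 0 and u0 = 0, already for b = 0, and
   the estimate would fail for every b. *)
Definition L2_estimate (R : realType) (b : R -> R) : Prop :=
  exists A T : R, 0 < T /\
    forall (T' : R) (I : set R), 0 < T' -> T' <= T ->
      [\/ I = `[0, T']%classic, I = `[- T', 0]%classic | I = `[- T', T']%classic] ->
    forall (f : R -> R -> R) (u0 : R -> R) (u : R -> R -> R),
      classical_solution b I f u0 u ->
      (LinftyL2norm I u < +oo)%E ->
      (LinftyL2norm I u <= A%:E * (L2norm u0 + L1L2norm I f))%E.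

(* Main.v *)
Require Import Defs.
From mathcomp Require Import all_boot all_order all_algebra.
From mathcomp Require Import all_classical all_reals all_analysis.
From mathcomp Require Import measurable_realfun ess_sup_inf ring lra.
Set Implicit Arguments.
Unset Strict Implicit.
Unset Printing Implicit Defensive.
Import Order.TTheory GRing.Theory Num.Theory.
Import numFieldNormedType.Exports.
Local Open Scope classical_set_scope.
Local Open Scope ring_scope.

(* Let B be a primitive of b, so that the integral in the condition is
   B(x + r t) - B(x). For large xi the wave packet
     u(x, t) = cos (xi x + xi^3 t + al) g(x + 3 xi^2 t - x0) exp(- B(x) / 3),
   with g a C^3 bump, travels at speed - 3 xi^2, and the amplitude
   exp(- B / 3) makes the equation hold up to a source of size O(xi). It
   covers the distance L = x0 - z within a time of order |L| / xi^2, over which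
   the source contributes O(1 / xi). Applying the estimate to the phases al = 0
   and al = - pi / 2 (so that the squares of the two solutions add up to the
   squared envelope) and letting xi tend to infinity gives
   exp(- B(z) / 3) <= D exp(- B(x0) / 3) with D depending only on b. *)

(** * Integrals and norms *)

Section monotonicity.
Import HBNNSimple.

(* Needed for t |-> L2norm (f ^~ t), whose measurability is not known. *)
Lemma ge0_le_integral_nomeas d (T : measurableType d) (R : realType)
    (mu : {measure set T -> \bar R}) (D : set T) (f g : T -> \bar R) :
  (forall x, D x -> 0 <= f x)%E -> (forall x, D x -> f x <= g x)%E ->
  (\int[mu]_(x in D) f x <= \int[mu]_(x in D) g x)%E.
Proof.
move=> f0 fg; rewrite !(integral_mkcond D).
have fg' x : ((f \_ D) x <= (g \_ D) x)%E by exact: lee_restrict.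
have f0' x : (0 <= (f \_ D) x)%E by exact: erestrict_ge0.
rewrite !ge0_integralTE//; last by move=> x; exact: le_trans (f0' x) (fg' x).
apply: ereal_sup_le => _ /= [h hf <-]; exists h => // x.
exact: le_trans (hf x) (fg' x).
Qed.

End monotonicity.

Section L2norm.
Variable R : realType.
Implicit Types (g : R -> R) (K c m : R).
Local Notation mu := (@lebesgue_measure R).

Lemma integral_sqr g :
  (\int[mu]_x (`|(EFin \o g) x| `^ 2) = \int[mu]_x ((g x) ^+ 2)%:E)%E.
Proof.
apply: eq_integral => x _ /=.
by rewrite powR_mulrn// real_normK// num_real.
Qed.

Lemma L2norm_sqr g : (L2norm g `^ 2 = \int[mu]_x ((g x) ^+ 2)%:E)%E.
Proof. by rewrite /L2norm poweR_Lnorm ?pnatr_eq0// integral_sqr. Qed.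

Lemma L2norm_le g K c : 0 <= K ->
  (forall x, `|g x| <= K) -> (forall x, 1 < `|x - c| -> g x = 0) ->
  (L2norm g <= (2 * K)%:E)%E.
Proof.
move=> K0 gK g0.
have H : (\int[mu]_x ((g x) ^+ 2)%:E <= ((2 * K) ^+ 2)%:E)%E.
  have : (\int[mu]_x ((g x) ^+ 2)%:E <=
          \int[mu]_x ((cst (K ^+ 2)%:E) \_ `[(c - 1)%R, (c + 1)%R]) x)%E.
    apply: ge0_le_integral_nomeas => x _; first by rewrite lee_fin sqr_ge0.
    rewrite /patch; case: ifPn.
      by move=> _; rewrite lee_fin -(real_normK (num_real (g x))) lerXn2r// nnegrE.
    move=> xc; rewrite g0 ?expr0n//=.
    rewrite ltNge; apply: contra xc; rewrite ler_norml inE/= in_itv/=; lra.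
  rewrite -integral_mkcond integral_cst//= lebesgue_measure_itv/= lte_fin.
  rewrite ifT; last by lra.
  move=> /le_trans; apply; rewrite -EFinB -EFinM lee_fin; nra.
rewrite -L2norm_sqr in H.
(* The bound on the square also excludes the value [+oo], whose square is [+oo]; nonnegativity
   excludes [-oo]. *)
have := Lnorm_ge0 mu 2%:E (EFin \o g).
rewrite -/(L2norm g); case: (L2norm g) H => [r| |]//.
  rewrite poweR_EFin !lee_fin => + r0; rewrite powR_mulrn//.
  by rewrite ler_pXn2r// nnegrE mulr_ge0.
by rewrite poweRyr ?pnatr_eq0// leye_eq.
Qed.

(** The pointwise lower bound holds on an interval of length 1, so integrating it gives m^2 <= K^2 +
    K^2 <= (2 K)^2. Neither function needs a lower bound alone: this suits two packets in
    quadrature, each of which vanishes at the zeros of its cosine. *)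
Lemma L2norm_pair_ge g1 g2 K c m :
  continuous g1 -> continuous g2 -> 0 <= m ->
  (L2norm g1 <= K%:E)%E -> (L2norm g2 <= K%:E)%E ->
  (forall x, `|x - c| <= 2^-1 -> m ^+ 2 <= g1 x ^+ 2 + g2 x ^+ 2) ->
  m <= 2 * K.
Proof.
move=> cg1 cg2 m0 g1K g2K gm.
have K0 : 0 <= K by rewrite -lee_fin; apply: le_trans g1K; exact: Lnorm_ge0.
have sqr g : (L2norm g <= K%:E)%E -> (\int[mu]_x ((g x) ^+ 2)%:E <= (K ^+ 2)%:E)%E.
  rewrite -L2norm_sqr.
  have := Lnorm_ge0 mu 2%:E (EFin \o g).
  rewrite -/(L2norm g); case: (L2norm g) => [r| |]//.
  rewrite poweR_EFin !lee_fin => r0 rK; rewrite powR_mulrn//.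
  by rewrite lerXn2r// nnegrE.
have : (\int[mu]_x ((cst (m ^+ 2)%:E) \_ `[(c - 2^-1)%R, (c + 2^-1)%R]) x <=
   \int[mu]_x (((g1 x) ^+ 2)%:E + ((g2 x) ^+ 2)%:E))%E.
  apply: ge0_le_integral_nomeas => x _.
    by apply: erestrict_ge0 => y _; rewrite lee_fin sqr_ge0.
  rewrite /patch; case: ifPn.
    rewrite inE/= in_itv/= => xc; rewrite -EFinD lee_fin gm// ler_norml; lra.
  by rewrite -EFinD lee_fin addr_ge0// sqr_ge0.
rewrite ge0_integralD//; [|by move=> x _; rewrite lee_fin sqr_ge0|
  by apply/measurable_EFinP; apply: measurable_funX;
    exact: continuous_measurable_fun|
  by move=> x _; rewrite lee_fin sqr_ge0|
  by apply/measurable_EFinP; apply: measurable_funX;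
    exact: continuous_measurable_fun].
rewrite -integral_mkcond integral_cst//= lebesgue_measure_itv/= lte_fin.
rewrite ifT; last by lra.
move=> /le_trans /(_ (leeD (sqr _ g1K) (sqr _ g2K))).
rewrite -!EFinD -EFinM lee_fin => H.
have : m ^+ 2 <= (2 * K) ^+ 2 by nra.
by rewrite ler_pXn2r// nnegrE mulr_ge0.
Qed.

End L2norm.

Section time_norms.
Variable R : realType.
Local Notation mu := (@lebesgue_measure R).

(** The norm of exponent [+oo] is defined by a case distinction on this positivity, through which it
    unfolds to an essential supremum. *)
Lemma lebesgue_measureT_gt0 : (0 < mu [set: R])%E.
Proof.
apply: (@lt_le_trans _ _ (mu `[0%R, 1%R]%classic)).
  by rewrite lebesgue_measure_itv/= lte_fin ltr01 sube0 lte_fin.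
by apply: le_measure; rewrite ?inE.
Qed.

Lemma LinftyL2norm_le (I : set R) (u : R -> R -> R) (K : R) : 0 <= K ->
  (forall t, I t -> L2norm (u ^~ t) <= K%:E)%E ->
  (LinftyL2norm I u <= K%:E)%E.
Proof.
move=> K0 uK; rewrite /LinftyL2norm unlock lebesgue_measureT_gt0.
apply/ess_supP/nearW => t /=.
rewrite /patch; case: ifPn => [/[!inE] It|_]; last by rewrite abse0 lee_fin.
by rewrite gee0_abs ?uK// Lnorm_ge0.
Qed.

Lemma LinftyL2norm_ae (I : set R) (u : R -> R -> R) (K : \bar R) :
  (LinftyL2norm I u <= K)%E ->
  {ae mu, forall t, I t -> (L2norm (u ^~ t) <= K)%E}.
Proof.
rewrite /LinftyL2norm unlock lebesgue_measureT_gt0 => /ess_supP.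
apply: filterS => t /= + It; rewrite /patch mem_set//.
by rewrite gee0_abs// Lnorm_ge0.
Qed.

(** The essential supremum controls only almost every time, so the time at which the packet is
    observed is picked in an interval of positive length, which no null set contains. *)
Lemma ae_itv_exists (a b : R) (P : R -> Prop) : a < b ->
  {ae mu, forall t, P t} -> exists2 t, `[a, b]%classic t & P t.
Proof.
move=> ab [N [mN N0 PN]].
apply: contrapT => nP.
have abN : `[a, b]%classic `<=` N.
  move=> t tab; apply: PN => /= Pt; apply: nP; by exists t.
have : (mu `[a, b]%classic <= mu N)%E by apply: le_measure; rewrite ?inE.
rewrite N0 lebesgue_measure_itv/= lte_fin ab -EFinB lee_fin; lra.
Qed.

Lemma L1L2norm_le (T' : R) (f : R -> R -> R) (K : R) : 0 < T' ->
  (forall t, `[- T', T']%classic t -> (L2norm (f ^~ t) <= K%:E)%E) ->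
  (L1L2norm `[(- T')%R, T']%classic f <= (2 * T' * K)%:E)%E.
Proof.
move=> T0 fK.
apply: (@le_trans _ _ (\int[mu]_(t in `[(- T')%R, T']) K%:E)%E).
  by apply: ge0_le_integral_nomeas => t It; [exact: Lnorm_ge0|exact: fK].
rewrite integral_cst//= lebesgue_measure_itv/= lte_fin ifT; last by lra.
rewrite -EFinB -EFinM lee_fin; lra.
Qed.

End time_norms.

(** * Derivatives and the bump function *)

Section pointwise_derivatives.
Variable R : realType.
Implicit Types (f g : R -> R) (x a b c k : R).

Lemma is_derive_continuous f x a : is_derive x 1 f a -> {for x, continuous f}.
Proof. by move=> [df _]; exact/differentiable_continuous/derivable1_diffP. Qed.

Lemma is_derive_mul f g x a b : is_derive x 1 f a -> is_derive x 1 g b ->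
  is_derive x 1 (fun y => f y * g y) (a * g x + f x * b).
Proof.
move=> df dg; have -> : (fun y => f y * g y) = f * g by [].
by apply: is_derive_eq; rewrite /GRing.scale/= addrC mulrC [X in _ + X]mulrC addrC.
Qed.

Lemma is_derive_add f g x a b : is_derive x 1 f a -> is_derive x 1 g b ->
  is_derive x 1 (fun y => f y + g y) (a + b).
Proof. by move=> df dg; exact: is_deriveD. Qed.

Lemma is_derive_const c x : is_derive x 1 (fun=> c) 0.
Proof. exact: is_derive_cst. Qed.

Lemma is_derive_id1 x : is_derive x 1 (fun y : R => y) 1.
Proof. exact: is_derive_id. Qed.

Lemma is_derive_compose f g x a b : is_derive (g x) 1 f a -> is_derive x 1 g b ->
  is_derive x 1 (fun y => f (g y)) (a * b).
Proof. by move=> df dg; exact: (@is_derive1_comp _ f g). Qed.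

Lemma is_derive_scale k f x a : is_derive x 1 f a ->
  is_derive x 1 (fun y => k * f y) (k * a).
Proof.
move=> df; apply: is_derive_eq (is_derive_mul (is_derive_const k x) df) _.
by rewrite mul0r add0r.
Qed.

(** Carathéodory's criterion with an explicit slope function: (z |z| - x |x|) / (z - x) equals |z| +
    |x| when z and x have the same sign. For x <> 0 this covers a neighbourhood of x, so the last
    branch does not affect continuity at x. *)
Lemma is_derive_mul_abs x : is_derive x 1 (fun v : R => v * `|v|) (2 * `|x|).
Proof.
apply/is_derive1_caratheodory.
exists (fun z => if x == 0 then `|z| else
                 if 0 < z * x then `|z| + `|x|
                 else (z * `|z| - x * `|x|) / (z - x)); split.
- move=> z; case: ifPn => [/eqP ->|x0]; first by rewrite mul0r !subr0 mulrC.
  case: ifPn => zx; last first.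
    have zx0 : z - x != 0.
      apply: contra zx; rewrite subr_eq0 => /eqP ->.
      by rewrite -expr2 exprn_even_gt0.
    by rewrite divfK.
  have [x1|x1|x1] := ltgtP x 0; last by rewrite x1 eqxx in x0.
    have z0 : z < 0 by rewrite nmulr_lgt0 in zx.
    by rewrite !ltr0_norm//; ring.
  have z0 : 0 < z by rewrite pmulr_lgt0 in zx.
  by rewrite !gtr0_norm//; ring.
- case: (eqVneq x 0) => [->|x0].
    exact: norm_continuous.
  have cvx : (fun z : R => `|z| + `|x|) @ x --> `|x| + `|x|.
    by apply: cvgD; [exact: norm_continuous|exact: cvg_cst].
  rewrite /prop_for /continuous_at /= -expr2 exprn_even_gt0//= x0.
  apply: cvg_trans cvx; apply: near_eq_cvg.
  have : \forall z \near x, 0 < z * x.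
    have /(_ x) : continuous (fun z : R => z * x).
      by move=> z; apply: cvgM; [exact: cvg_id|exact: cvg_cst].
    move=> /cvgr_gt; apply.
    by rewrite -expr2 exprn_even_gt0.
  by apply: filterS => z zx; rewrite zx.
- case: eqVneq => [->|x0]; first by rewrite normr0 mulr0.
  by rewrite -expr2 exprn_even_gt0//= x0; ring.
Qed.

End pointwise_derivatives.

Section bump.
Variable R : realType.

Lemma bump_exists : exists (g0 g1 g2 g3 : R -> R) (M : R),
  [/\ [/\ forall y : R, is_derive y 1 g0 (g1 y),
          forall y : R, is_derive y 1 g1 (g2 y),
          forall y : R, is_derive y 1 g2 (g3 y) & continuous g3],
      forall y : R, [/\ `|g0 y| <= M, `|g1 y| <= M, `|g2 y| <= M & `|g3 y| <= M],
      forall y : R, 1 < `|y| -> [/\ g0 y = 0, g1 y = 0, g2 y = 0 & g3 y = 0] &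
      forall y : R, `|y| <= 2^-1 -> 2^-1 <= g0 y].
Proof.
pose P (v : R) := v * `|v|.
have dP (v : R) : is_derive v 1 P (2 * `|v|) by exact: is_derive_mul_abs.
(* Q4 v = 2 max(v, 0)^4 and its derivatives; v |v| is C^1, which avoids any
   case analysis at v = 0. *)
pose Q4 (v : R) := v * v * (v * v) + v * v * P v.
pose Q3 (v : R) := 4 * (v * (v * v)) + 4 * (v * P v).
pose Q2 (v : R) := 12 * (v * v) + 12 * P v.
pose Q1 (v : R) := 24 * v + 24 * `|v|.
have dvv (v : R) : is_derive v 1 (fun v : R => v * v) (2 * v).
  apply: is_derive_eq (is_derive_mul (is_derive_id1 v) (is_derive_id1 v)) _; ring.
have dQ4 (v : R) : is_derive v 1 Q4 (Q3 v).
  apply: is_derive_eq (is_derive_add (is_derive_mul (dvv v) (dvv v))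
    (is_derive_mul (dvv v) (dP v))) _.
  rewrite /Q3 /P; ring.
have dQ3 (v : R) : is_derive v 1 Q3 (Q2 v).
  apply: is_derive_eq (is_derive_add
    (is_derive_scale 4 (is_derive_mul (is_derive_id1 v) (dvv v)))
    (is_derive_scale 4 (is_derive_mul (is_derive_id1 v) (dP v)))) _.
  rewrite /Q2 /P; ring.
have dQ2 (v : R) : is_derive v 1 Q2 (Q1 v).
  apply: is_derive_eq (is_derive_add (is_derive_scale 12 (dvv v))
    (is_derive_scale 12 (dP v))) _.
  rewrite /Q1 /P; ring.
(* [w y] = 1 - y^2 is positive exactly when |y| < 1, so the bump [Q4 (w y)] is 2 max(1 - y^2,
   0)^4. *)
pose w (y : R) := 1 + - 1 * (y * y).
have dw (y : R) : is_derive y 1 w (- 2 * y).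
  apply: is_derive_eq (is_derive_add (is_derive_const 1 y)
    (is_derive_scale (- 1) (dvv y))) _; ring.
have wneg (y : R) : 1 < `|y| -> w y < 0.
  by move=> y1; rewrite /w -expr2 -(real_normK (num_real y)); nra.
have Pneg (v : R) : v < 0 -> P v = - (v * v).
  by move=> v0; rewrite /P ltr0_norm// mulrN.
have Ppos (v : R) : 0 <= v -> P v = v * v by move=> v0; rewrite /P ger0_norm.
have wpos (y : R) : `|y| <= 1 -> 0 <= w y <= 1.
  move=> y1; rewrite /w -expr2 -(real_normK (num_real y)).
  by have := normr_ge0 y; nra.
pose g0 (y : R) := Q4 (w y).
pose g1 (y : R) := Q3 (w y) * (- 2 * y).
pose g2 (y : R) := Q2 (w y) * (4 * (y * y)) + Q3 (w y) * - 2.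
pose g3 (y : R) := Q1 (w y) * (- 8 * (y * (y * y))) + Q2 (w y) * (12 * y).
have zero (y : R) : 1 < `|y| -> [/\ g0 y = 0, g1 y = 0, g2 y = 0 & g3 y = 0].
  move=> /wneg v0; rewrite /g0 /g1 /g2 /g3 /Q4 /Q3 /Q2 /Q1 Pneg// ltr0_norm//.
  by split; ring.
(* The largest of the four bounds is that of [g3]: on |y| <= 1 one has [Q1] = 48 w and [Q2] = 24 w^2
   with 0 <= w <= 1, and 48 * 8 + 24 * 12 = 672. *)
exists g0, g1, g2, g3, 672; split => //.
- split.
  + by move=> y; apply: is_derive_eq (is_derive_compose (dQ4 (w y)) (dw y)) _.
  + move=> y; apply: is_derive_eq (is_derive_mul
      (is_derive_compose (dQ3 (w y)) (dw y))
      (is_derive_scale (- 2) (is_derive_id1 y))) _.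
    rewrite /g2; ring.
  + move=> y; apply: is_derive_eq (is_derive_add
      (is_derive_mul (is_derive_compose (dQ2 (w y)) (dw y))
        (is_derive_scale 4 (dvv y)))
      (is_derive_mul (is_derive_compose (dQ3 (w y)) (dw y))
        (is_derive_const (- 2) y))) _.
    rewrite /g3; ring.
  + move=> y.
    have cw : {for y, continuous w} by exact: is_derive_continuous (dw y).
    apply: cvgD; apply: cvgM.
    * apply: cvgD; apply: cvgM; try exact: cvg_cst; first exact: cw.
      by apply: cvg_norm; exact: cw.
    * by do 3 ?[apply: cvgM]; try exact: cvg_cst; exact: cvg_id.
    * exact: (continuous_comp cw (is_derive_continuous (dQ2 _))).
    * by apply: cvgM; [exact: cvg_cst|exact: cvg_id].
- move=> y; have [y1|y1] := leP `|y| 1; last first.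
    by have [-> -> -> ->] := zero _ y1; rewrite normr0; split; lra.
  have := wpos _ y1.
  rewrite /g0 /g1 /g2 /g3 /Q4 /Q3 /Q2 /Q1.
  move: (w y) => v /andP[v0 v1]; rewrite Ppos// [`|v|]ger0_norm//.
  have v2 : 0 <= v * v <= 1 by nra.
  have v3 : 0 <= v * (v * v) <= 1 by nra.
  have v4 : 0 <= v * v * (v * v) <= 1 by nra.
  move: y1; rewrite ler_norml => /andP[ya yb].
  have y2 : 0 <= y * y <= 1 by nra.
  have y3 : - 1 <= y * (y * y) <= 1 by nra.
  (* The powers of v and y become independent bounded variables, so that only products of low degree
     remain for [nra]. *)
  move: (v * (v * v)) v3 => v3 v3b; move: (v * v) v2 v4 => v2 v2b v4.
  move: (y * (y * y)) y3 => y3 y3b; move: (y * y) y2 => y2 y2b.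
  have h1 : 0 <= v3 * y + v3 <= 2 by nra.
  have h2 : 0 <= v2 * y2 <= 1 by nra.
  have h3 : 0 <= v * y3 + v <= 2 by nra.
  have h4 : 0 <= v2 * y + v2 <= 2 by nra.
  split; rewrite ler_norml; nra.
- move=> y yh; rewrite /g0 /Q4.
  (* This suffices because 2 (3/4)^4 = 81/128 >= 1/2. *)
  have vb : 3 / 4 <= w y.
    by rewrite /w -expr2 -(real_normK (num_real y)); have := normr_ge0 y; nra.
  rewrite Ppos; last by lra.
  move: (w y) vb => v vb.
  have : 9 / 16 <= v * v by nra.
  by move: (v * v) => v2 hv; nra.
Qed.

End bump.

(** * Primitives and the amplitude *)

Section antiderivative.
Variable R : realType.
Implicit Types (f F b B : R -> R).
Local Notation mu := (@lebesgue_measure R).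

Lemma continuous_integrable_itv f (a c : R) : continuous f ->
  mu.-integrable `[a, c] (EFin \o f).
Proof.
move=> cf; apply: continuous_compact_integrable; first exact: segment_compact.
exact: continuous_subspaceT.
Qed.

Lemma Rintegral_FTC2 f F (a c : R) : continuous f ->
  (forall x : R, is_derive x 1 F (f x)) -> a <= c ->
  (\int[mu]_(x in `[a, c]) f x)%R = F c - F a.
Proof.
move=> cf dF; rewrite le_eqVlt => /predU1P[->|ac].
  by rewrite set_itv1 Rintegral_set1 subrr.
have cF : continuous F by move=> x; exact: is_derive_continuous (dF x).
rewrite /Rintegral (continuous_FTC2 (F := F) ac)//.
- exact: continuous_subspaceT.
- split.
  + by move=> x _; case: (dF x).
  + exact: cvg_at_right_filter (cF a).
  + exact: cvg_at_left_filter (cF c).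
- by move=> x _; rewrite derive1E; case: (dF x).
Qed.

Lemma antiderivative_exists f : continuous f ->
  exists F, forall x : R, is_derive x 1 F (f x).
Proof.
move=> cf.
pose G (a x : R) := (\int[mu]_(t in `[a, x]) f t)%R.
exists (fun x => if 0 <= x then \int[mu]_(t in `]0, x]) f t
                 else - \int[mu]_(t in `]x, 0]) f t)%R.
(* With a to the left of both x and 0, the primitive equals G a y - G a 0 for all y near x, whatever
   the sign of y, and the fundamental theorem applies to G a. *)
move=> x; pose a := Num.min x 0 - 1.
have ax : a < x by rewrite /a; have := ge_min x x 0; lra.
have a0 : a < 0 by rewrite /a; have := ge_min 0 x 0; lra.
apply: (@near_eq_is_derive _ _ _ (fun y => G a y + - G a 0)).
  have : \forall y \near x, a < y by apply: lt_nbhsr.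
  apply: filterS => y ay; rewrite /G.
  case: ifPn => y0.
    by apply: Rintegral_itvB; [exact: continuous_integrable_itv|
      rewrite bnd_simp ltW|rewrite bnd_simp].
  rewrite -opprB; congr (- _).
  apply: Rintegral_itvB; first exact: continuous_integrable_itv.
    by rewrite bnd_simp ltW.
  by rewrite bnd_simp ltW// ltNge.
have xx1 : x < x + 1 by lra.
have [dG GE] := continuous_FTC1_closed xx1 (continuous_integrable_itv a (x + 1) cf)
  ax (cf x).
apply: is_derive_eq (is_derive_add _ (is_derive_const (- G a 0) x)) _.
  exact: derivableP dG.
by rewrite addr0 -derive1E.
Qed.

Lemma integral_from0_antiderivative b B (x t r : R) : continuous b ->
  (forall x : R, is_derive x 1 B (b x)) ->
  integral_from0 t (fun s => b (x + r * s) * r) = B (x + r * t) - B x.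
Proof.
move=> cb dB.
have dF (s : R) : is_derive s 1 (fun s => B (x + r * s)) (b (x + r * s) * r).
  apply: is_derive_eq (is_derive_compose (dB _)
    (is_derive_add (is_derive_const x s) (is_derive_scale r (is_derive_id1 s)))) _.
  by rewrite add0r mulr1.
have cF : continuous (fun s => b (x + r * s) * r).
  move=> /= s; apply: (@cvgM _ _ _ _ (fun s => b (x + r * s)) (cst r));
    last exact: cvg_cst.
  apply: (@cvg_comp _ _ _ (fun s => x + r * s) b); last exact: cb.
  by apply: cvgD; first exact: cvg_cst; apply: cvgM; [exact: cvg_cst|exact: cvg_id].
rewrite /integral_from0; case: ifPn => t0.
  by rewrite (Rintegral_FTC2 cF dF t0) mulr0 addr0.
have /ltW t0' : t < 0 by rewrite ltNge.
by rewrite (Rintegral_FTC2 cF dF t0') mulr0 addr0 opprB.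
Qed.

Lemma lipschitz_of_derivative F f (M : R) :
  (forall x : R, is_derive x 1 F (f x)) -> (forall x, `|f x| <= M) ->
  forall x y, F y - F x <= M * `|y - x|.
Proof.
move=> dF fM.
have cF : continuous F by move=> x; exact: is_derive_continuous (dF x).
have key x y : x <= y -> `|F y - F x| <= M * `|y - x|.
  move=> xy; have [|c _ ->] := MVT_segment xy (fun z _ => dF z).
    exact: continuous_subspaceT.
  by rewrite normrM ler_wpM2r.
move=> x y; apply: le_trans (ler_norm _) _.
have [xy|/ltW xy] := leP x y; first exact: key.
by rewrite distrC (distrC y) key.
Qed.

End antiderivative.

Section amplitude.
Variable R : realType.

(** Each derivative of h is h times a polynomial in b, b', b''. The bounds are relative to h because
    h itself is not known to be bounded: that is what is to be proved. Two bounded derivatives of b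
    give the three derivatives of h that the equation requires. *)
Lemma amplitude_exists (b B : R -> R) : C2_bounded b ->
  (forall x : R, is_derive x 1 B (b x)) ->
  let h := fun x => expR (- 3^-1 * B x) in
  exists (h2 h3 : R -> R) (N : R),
    let h1 := fun x => - 3^-1 * b x * h x in
  [/\ forall x : R, is_derive x 1 h (h1 x), forall x : R, is_derive x 1 h1 (h2 x),
      forall x : R, is_derive x 1 h2 (h3 x), continuous h3 &
      forall x : R, [/\ `|h1 x| <= N * h x, `|h2 x| <= N * h x &
                        `|h3 x| <= N * h x]].
Proof.
move=> [db cb2 bb] dB h.
pose b1 : R -> R := (b^`(1))%classic; pose b2 : R -> R := (b^`(2))%classic.
have db0 (x : R) : is_derive x 1 b (b1 x).
  by rewrite /b1 derive1n1 derive1E; apply: derivableP; exact: (db 0%N).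
have db1 (x : R) : is_derive x 1 b1 (b2 x).
  by rewrite /b2 derive1nS derive1E; apply: derivableP; exact: (db 1%N).
have [M0 bM0] := bb 0%N isT.
have [M1 bM1] := bb 1%N isT.
have [M2 bM2] := bb 2%N isT.
have dh (x : R) : is_derive x 1 h (- 3^-1 * b x * h x).
  apply: is_derive_eq (is_derive_compose (is_derive_expR _)
    (is_derive_scale (- 3^-1) (dB x))) _.
  by rewrite mulrC.
(* h'' = [p2] h and h''' = [p3] h, where [p3] = [p2]' - [p2] b / 3. *)
pose p2 x := 9^-1 * (b x * b x) + - 3^-1 * b1 x.
pose p3 x := 9^-1 * (2 * b x * b1 x) + - 3^-1 * b2 x + p2 x * (- 3^-1 * b x).
have dp2 (x : R) : is_derive x 1 p2 (9^-1 * (2 * b x * b1 x) + - 3^-1 * b2 x).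
  apply: is_derive_eq (is_derive_add
    (is_derive_scale (9^-1) (is_derive_mul (db0 x) (db0 x)))
    (is_derive_scale (- 3^-1) (db1 x))) _.
  by congr (_ + _); ring.
exists (fun x => p2 x * h x), (fun x => p3 x * h x).
(* The sum of the separate bounds for b / 3, [p2] and [p3]. *)
exists (`|M0| + (M0 * M0 + `|M1|) +
  (2 * `|M0| * `|M1| + `|M2| + (M0 * M0 + `|M1|) * `|M0|)).
have h0 x : 0 < h x by exact: expR_gt0.
split.
- exact: dh.
- move=> x; apply: is_derive_eq (is_derive_mul
    (is_derive_scale (- 3^-1) (db0 x)) (dh x)) _.
  by rewrite /p2; field.
- move=> x; apply: is_derive_eq (is_derive_mul (dp2 x) (dh x)) _.
  by rewrite /p3 [RHS]mulrDl -!mulrA.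
- have cB1 (x : R) := is_derive_continuous (db0 x).
  have cB2 (x : R) := is_derive_continuous (db1 x).
  move=> x; apply: cvgM; last exact: is_derive_continuous (dh x).
  apply: cvgD; first apply: cvgD.
  + apply: cvgM; first exact: cvg_cst.
    apply: cvgM; last exact: cB2.
    by apply: cvgM; [exact: cvg_cst|exact: cB1].
  + by apply: cvgM; [exact: cvg_cst|exact: cb2].
  + apply: cvgM; first exact: is_derive_continuous (dp2 x).
    by apply: cvgM; [exact: cvg_cst|exact: cB1].
- move=> x; rewrite !normrM (gtr0_norm (h0 x)).
  have B0 : `|b x| <= `|M0| by apply: le_trans (bM0 x) (ler_norm _).
  have B1 : `|b1 x| <= `|M1| by apply: le_trans (bM1 x) (ler_norm _).
  have B2 : `|b2 x| <= `|M2| by apply: le_trans (bM2 x) (ler_norm _).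
  have M00 : M0 * M0 = `|M0| * `|M0| by rewrite -normrM ger0_norm// -expr2 sqr_ge0.
  have n0 : 0 <= `|M0| by []. have n1 : 0 <= `|M1| by []. have n2 : 0 <= `|M2| by [].
  have a0 : 0 <= `|b x| by []. have a1 : 0 <= `|b1 x| by [].
  have P2 : `|p2 x| <= M0 * M0 + `|M1|.
    apply: le_trans (ler_normD _ _) _.
    rewrite !normrM normrN !normfV !normr_nat M00; nra.
  have P3 : `|p3 x| <= 2 * `|M0| * `|M1| + `|M2| + (M0 * M0 + `|M1|) * `|M0|.
    apply: le_trans (ler_normD _ _) _.
    apply: lerD.
      apply: le_trans (ler_normD _ _) _.
      rewrite !normrM normrN !normfV !normr_nat; nra.
    rewrite !normrM normrN !normfV !normr_nat; apply: ler_pM => //.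
    nra.
  have Q0 : 0 <= M0 * M0 by rewrite M00 mulr_ge0.
  split; apply: ler_wpM2r; try exact: ltW.
  + rewrite normrN normfV normr_nat.
    have : 0 <= 2 * `|M0| * `|M1| + `|M2| + (M0 * M0 + `|M1|) * `|M0|.
      by apply: le_trans P3.
    lra.
  + have : 0 <= 2 * `|M0| * `|M1| + `|M2| + (M0 * M0 + `|M1|) * `|M0|.
      by apply: le_trans P3.
    lra.
  + lra.
Qed.

End amplitude.

(** * Wave packets *)

(** The Carathéodory slope function is continuous at t and agrees with the difference quotient away
    from t; its limit passes to any smaller filter. *)
Lemma is_derive_is_derive_within (R : realType) (I : set R) (g : R -> R) (t l : R) :
  is_derive t 1 g l -> is_derive_within I g t l.
Proof.
move=> /is_derive1_caratheodory[k [gk ck <-]].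
have ckt : k s @[s --> t^'] --> k t by exact: cvg_within_filter.
apply: (@cvg_within_filter _ _ _ (t^')).
apply: cvg_trans ckt; apply: near_eq_cvg.
near=> s.
rewrite gk mulfK// subr_eq0; near: s; exact: nbhs_dnbhs_neq.
Unshelve. all: by end_near. Qed.

Lemma is_derive_derive1 (R : realType) (f df : R -> R) :
  (forall x : R, is_derive x 1 f (df x)) -> (f^`())%classic = df.
Proof. by move=> fdf; apply/funext => x; rewrite derive1E; case: (fdf x). Qed.

Section wave_packet.
Variable R : realType.
Variables (b g0 g1 g2 g3 h0 h1 h2 h3 : R -> R).
Hypothesis dg0 : forall x : R, is_derive x 1 g0 (g1 x).
Hypothesis dg1 : forall x : R, is_derive x 1 g1 (g2 x).
Hypothesis dg2 : forall x : R, is_derive x 1 g2 (g3 x).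
Hypothesis cg3 : continuous g3.
Hypothesis dh0 : forall x : R, is_derive x 1 h0 (h1 x).
Hypothesis dh1 : forall x : R, is_derive x 1 h1 (h2 x).
Hypothesis dh2 : forall x : R, is_derive x 1 h2 (h3 x).
Hypothesis ch3 : continuous h3.
Hypothesis h1E : forall x, h1 x = - 3^-1 * b x * h0 x.
Variables (xi al x0 : R).

(** The frequency xi^3 obeys the dispersion relation of d_t + d_x^3, and [shift] follows the
    corresponding group velocity - 3 xi^2. *)
Definition phase (x t : R) := xi * x + (xi ^+ 3 * t + al).
Definition shift (x t : R) := x + (3 * xi ^+ 2 * t + - x0).

Definition env0 x t := g0 (shift x t) * h0 x.
Definition env1 x t := g1 (shift x t) * h0 x + g0 (shift x t) * h1 x.
Definition env2 x t := g2 (shift x t) * h0 x + 2 * (g1 (shift x t) * h1 x)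
  + g0 (shift x t) * h2 x.
Definition env3 x t := g3 (shift x t) * h0 x + 3 * (g2 (shift x t) * h1 x)
  + 3 * (g1 (shift x t) * h2 x) + g0 (shift x t) * h3 x.

Definition packet x t := cos (phase x t) * env0 x t.
Definition packet1 x t :=
  - xi * (sin (phase x t) * env0 x t) + cos (phase x t) * env1 x t.
Definition packet2 x t :=
  - xi ^+ 2 * (cos (phase x t) * env0 x t)
  + - (2 * xi) * (sin (phase x t) * env1 x t) + cos (phase x t) * env2 x t.
Definition packet3 x t :=
  xi ^+ 3 * (sin (phase x t) * env0 x t)
  + - (3 * xi ^+ 2) * (cos (phase x t) * env1 x t)
  + - (3 * xi) * (sin (phase x t) * env2 x t) + cos (phase x t) * env3 x t.
Definition packet_t x t :=
  - xi ^+ 3 * (sin (phase x t) * env0 x t)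
  + 3 * xi ^+ 2 * (cos (phase x t) * (g1 (shift x t) * h0 x)).
(* The terms of order [xi ^+ 3] and, by the choice of [h0], of order
   [xi ^+ 2] cancel in the equation. *)
Definition source x t :=
  - (3 * xi) * (sin (phase x t) * env2 x t) + cos (phase x t) * env3 x t
  + b x * (- (2 * xi) * (sin (phase x t) * env1 x t) + cos (phase x t) * env2 x t).

Let dphase_x t (x : R) : is_derive x 1 (phase ^~ t) xi.
Proof.
apply: is_derive_eq (is_derive_add (is_derive_scale xi (is_derive_id1 x))
  (is_derive_const (xi ^+ 3 * t + al) x)) _.
by rewrite mulr1 addr0.
Qed.

Let dphase_t x (t : R) : is_derive t 1 (phase x) (xi ^+ 3).
Proof.
apply: is_derive_eq (is_derive_add (is_derive_const (xi * x) t)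
  (is_derive_add (is_derive_scale (xi ^+ 3) (is_derive_id1 t))
  (is_derive_const al t))) _.
by rewrite mulr1 addr0 add0r.
Qed.

Let dshift_x t (x : R) : is_derive x 1 (shift ^~ t) 1.
Proof.
apply: is_derive_eq (is_derive_add (is_derive_id1 x)
  (is_derive_const (3 * xi ^+ 2 * t + - x0) x)) _.
by rewrite addr0.
Qed.

Let dshift_t x (t : R) : is_derive t 1 (shift x) (3 * xi ^+ 2).
Proof.
apply: is_derive_eq (is_derive_add (is_derive_const x t)
  (is_derive_add (is_derive_scale (3 * xi ^+ 2) (is_derive_id1 t))
  (is_derive_const (- x0) t))) _.
by rewrite mulr1 addr0 add0r.
Qed.

Let dcos_x t (x : R) :
  is_derive x 1 (fun x => cos (phase x t)) (- sin (phase x t) * xi).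
Proof. exact: is_derive_compose (is_derive_cos _) (dphase_x t x). Qed.

Let dsin_x t (x : R) :
  is_derive x 1 (fun x => sin (phase x t)) (cos (phase x t) * xi).
Proof. exact: is_derive_compose (is_derive_sin _) (dphase_x t x). Qed.

Let dg_x (g g' : R -> R) t (x : R) : (forall x : R, is_derive x 1 g (g' x)) ->
  is_derive x 1 (fun x => g (shift x t)) (g' (shift x t)).
Proof.
move=> dg; apply: is_derive_eq (is_derive_compose (dg _) (dshift_x t x)) _.
by rewrite mulr1.
Qed.

Let denv0 t (x : R) : is_derive x 1 (env0 ^~ t) (env1 x t).
Proof. exact: is_derive_mul (dg_x t x dg0) (dh0 x). Qed.

Let denv1 t (x : R) : is_derive x 1 (env1 ^~ t) (env2 x t).
Proof.
apply: is_derive_eq (is_derive_add (is_derive_mul (dg_x t x dg1) (dh0 x))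
  (is_derive_mul (dg_x t x dg0) (dh1 x))) _.
rewrite /env2; ring.
Qed.

Let denv2 t (x : R) : is_derive x 1 (env2 ^~ t) (env3 x t).
Proof.
apply: is_derive_eq (is_derive_add (is_derive_add
  (is_derive_mul (dg_x t x dg2) (dh0 x))
  (is_derive_scale 2 (is_derive_mul (dg_x t x dg1) (dh1 x))))
  (is_derive_mul (dg_x t x dg0) (dh2 x))) _.
rewrite /env3; ring.
Qed.

Lemma is_derive_packet t (x : R) : is_derive x 1 (packet ^~ t) (packet1 x t).
Proof.
apply: is_derive_eq (is_derive_mul (dcos_x t x) (denv0 t x)) _.
rewrite /packet1; ring.
Qed.

Lemma is_derive_packet1 t (x : R) : is_derive x 1 (packet1 ^~ t) (packet2 x t).
Proof.
apply: is_derive_eq (is_derive_add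
  (is_derive_scale (- xi) (is_derive_mul (dsin_x t x) (denv0 t x)))
  (is_derive_mul (dcos_x t x) (denv1 t x))) _.
rewrite /packet2; ring.
Qed.

Lemma is_derive_packet2 t (x : R) : is_derive x 1 (packet2 ^~ t) (packet3 x t).
Proof.
apply: is_derive_eq (is_derive_add (is_derive_add
  (is_derive_scale (- xi ^+ 2) (is_derive_mul (dcos_x t x) (denv0 t x)))
  (is_derive_scale (- (2 * xi)) (is_derive_mul (dsin_x t x) (denv1 t x))))
  (is_derive_mul (dcos_x t x) (denv2 t x))) _.
rewrite /packet3; ring.
Qed.

Lemma is_derive_packet_t x (t : R) : is_derive t 1 (packet x) (packet_t x t).
Proof.
apply: is_derive_eq (is_derive_mul
  (is_derive_compose (is_derive_cos _) (dphase_t x t))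
  (is_derive_mul (is_derive_compose (dg0 _) (dshift_t x t))
    (is_derive_const (h0 x) t))) _.
rewrite /packet_t /env0; ring.
Qed.

(** * Joint continuity in space and time *)

Let cphase : continuous (fun z : R * R => phase z.1 z.2).
Proof.
move=> z; apply: cvgD; last apply: cvgD; last exact: cvg_cst.
  by apply: cvgM; [exact: cvg_cst|exact: cvg_fst].
by apply: cvgM; [exact: cvg_cst|exact: cvg_snd].
Qed.

Let cshift : continuous (fun z : R * R => shift z.1 z.2).
Proof.
move=> z; apply: cvgD; first exact: cvg_fst.
apply: cvgD; last exact: cvg_cst.
by apply: cvgM; [exact: cvg_cst|exact: cvg_snd].
Qed.

Let ccomp (F : R * R -> R) (g : R -> R) : continuous F -> continuous g ->
  continuous (fun z => g (F z)).
Proof. by move=> cF cg z; apply: (@cvg_comp _ _ _ F g); [exact: cF|exact: cg]. Qed.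

Let ccos : continuous (fun z : R * R => cos (phase z.1 z.2)).
Proof. exact: ccomp cphase (@continuous_cos R). Qed.

Let csin : continuous (fun z : R * R => sin (phase z.1 z.2)).
Proof. exact: ccomp cphase (@continuous_sin R). Qed.

Let cg (g : R -> R) : continuous g ->
  continuous (fun z : R * R => g (shift z.1 z.2)).
Proof. exact: ccomp cshift. Qed.

Let ch (h : R -> R) : continuous h -> continuous (fun z : R * R => h z.1).
Proof. by apply: ccomp => z; exact: cvg_fst. Qed.

Let cderiv (g g' : R -> R) : (forall x : R, is_derive x 1 g (g' x)) -> continuous g.
Proof. by move=> dg x; exact: is_derive_continuous (dg x). Qed.

Let cgh (g h : R -> R) : continuous g -> continuous h ->
  continuous (fun z : R * R => g (shift z.1 z.2) * h z.1).
Proof. by move=> cg0 ch0 z; apply: cvgM; [exact: cg|exact: ch]. Qed.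

Let ckM (k : R) (F : R * R -> R) : continuous F -> continuous (fun z => k * F z).
Proof. by move=> cF z; apply: cvgM; [exact: cvg_cst|exact: cF]. Qed.

Let cD (F G : R * R -> R) : continuous F -> continuous G ->
  continuous (fun z => F z + G z).
Proof. by move=> cF cG z; apply: cvgD; [exact: cF|exact: cG]. Qed.

Let cM (F G : R * R -> R) : continuous F -> continuous G ->
  continuous (fun z => F z * G z).
Proof. by move=> cF cG z; apply: cvgM; [exact: cF|exact: cG]. Qed.

Let cg0 := cderiv dg0. Let cg1 := cderiv dg1. Let cg2 := cderiv dg2.
Let ch0 := cderiv dh0. Let ch1 := cderiv dh1. Let ch2 := cderiv dh2.

Let cenv0 : continuous (fun z : R * R => env0 z.1 z.2).
Proof. exact: cgh. Qed.

Let cenv1 : continuous (fun z : R * R => env1 z.1 z.2).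
Proof. exact: cD (cgh cg1 ch0) (cgh cg0 ch1). Qed.

Let cenv2 : continuous (fun z : R * R => env2 z.1 z.2).
Proof. exact: cD (cD (cgh cg2 ch0) (@ckM 2 _ (cgh cg1 ch1))) (cgh cg0 ch2). Qed.

Let cenv3 : continuous (fun z : R * R => env3 z.1 z.2).
Proof.
exact: cD (cD (cD (cgh cg3 ch0) (@ckM 3 _ (cgh cg2 ch1))) (@ckM 3 _ (cgh cg1 ch2)))
  (cgh cg0 ch3).
Qed.

Lemma continuous_packet : continuous (fun z : R * R => packet z.1 z.2).
Proof. exact: cM ccos cenv0. Qed.

Let cpacket1 : continuous (fun z : R * R => packet1 z.1 z.2).
Proof. exact: cD (@ckM (- xi) _ (cM csin cenv0)) (cM ccos cenv1). Qed.

Let cpacket2 : continuous (fun z : R * R => packet2 z.1 z.2).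
Proof.
exact: cD (cD (@ckM (- xi ^+ 2) _ (cM ccos cenv0)) 
  (@ckM (- (2 * xi)) _ (cM csin cenv1))) (cM ccos cenv2).
Qed.

Let cpacket3 : continuous (fun z : R * R => packet3 z.1 z.2).
Proof.
exact: cD (cD (cD (@ckM (xi ^+ 3) _ (cM csin cenv0))
  (@ckM (- (3 * xi ^+ 2)) _ (cM ccos cenv1)))
  (@ckM (- (3 * xi)) _ (cM csin cenv2))) (cM ccos cenv3).
Qed.

Let cpacket_t : continuous (fun z : R * R => packet_t z.1 z.2).
Proof.
exact: cD (@ckM (- xi ^+ 3) _ (cM csin cenv0))
  (@ckM (3 * xi ^+ 2) _ (cM ccos (cgh cg1 ch0))).
Qed.

(** At order xi^2 the terms in [g1] from the time derivative and from [packet3] cancel; what is left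
    is - xi^2 cos(phase) g0 (3 h1 + b h0), which is zero by [h1E]. *)
Lemma packet_equation x t :
  packet_t x t + packet3 x t + b x * packet2 x t = source x t.
Proof.
rewrite /packet_t /packet3 /packet2 /source /env1 /env0 h1E.
by field.
Qed.

Let dx1 : dx 1 packet = packet1.
Proof.
apply/funext => x; apply/funext => t; rewrite /dx derive1n1.
by rewrite (is_derive_derive1 (is_derive_packet t)).
Qed.

Let dx2 : dx 2 packet = packet2.
Proof.
apply/funext => x; apply/funext => t; rewrite /dx derive1nS derive1n1.
rewrite (is_derive_derive1 (is_derive_packet t)).
by rewrite (is_derive_derive1 (is_derive_packet1 t)).
Qed.

Let dx3 : dx 3 packet = packet3.
Proof.
apply/funext => x; apply/funext => t; rewrite /dx 2!derive1nS derive1n1.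
rewrite (is_derive_derive1 (is_derive_packet t)).
rewrite (is_derive_derive1 (is_derive_packet1 t)).
by rewrite (is_derive_derive1 (is_derive_packet2 t)).
Qed.

Lemma packet_solution (I : set R) :
  classical_solution b I source (packet ^~ 0) packet.
Proof.
exists packet_t; split => //.
- split.
  + case=> [|[|[|]]]// _ t _ x.
    * by rewrite dx1; case: (is_derive_packet1 t x).
    * by rewrite dx2; case: (is_derive_packet2 t x).
  + case=> [|[|[|[|]]]]// _; rewrite ?dx1 ?dx2 ?dx3; apply: continuous_subspaceT.
    * by rewrite (_ : dx 0 packet = packet)//; exact: continuous_packet.
    * exact: cpacket1.
    * exact: cpacket2.
    * exact: cpacket3.
- by move=> x t _; exact: is_derive_is_derive_within (is_derive_packet_t x t).
- exact: continuous_subspaceT.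
- by move=> x t _; rewrite dx2 dx3 packet_equation.
Qed.

Lemma continuous_packet_x t : continuous (packet ^~ t).
Proof. by move=> x; exact: is_derive_continuous (is_derive_packet t x). Qed.

(** * Size and support of the packet and its source *)

Variables (M N Bm : R).
Hypothesis g_bound : forall y : R,
  [/\ `|g0 y| <= M, `|g1 y| <= M, `|g2 y| <= M & `|g3 y| <= M].
Hypothesis g_supp : forall y : R, 1 < `|y| ->
  [/\ g0 y = 0, g1 y = 0, g2 y = 0 & g3 y = 0].
Hypothesis h_pos : forall x, 0 < h0 x.
Hypothesis h_bound : forall x : R,
  [/\ `|h1 x| <= N * h0 x, `|h2 x| <= N * h0 x & `|h3 x| <= N * h0 x].
Hypothesis N1 : 1 <= N.
Hypothesis b_bound : forall x, `|b x| <= Bm.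
Hypothesis xi1 : 1 <= xi.

Let M0 : 0 <= M.
Proof. by have [+ _ _ _] := g_bound 0; apply: le_trans. Qed.

Let mul_cos (a c d : R) : `|c| <= d -> `|cos a * c| <= d.
Proof.
move=> cd; rewrite normrM; apply: le_trans cd.
by rewrite ler_piMl// ler_norml cos_geN1 cos_le1.
Qed.

Let mul_sin (a c d : R) : `|c| <= d -> `|sin a * c| <= d.
Proof.
move=> cd; rewrite normrM; apply: le_trans cd.
by rewrite ler_piMl// ler_norml sin_geN1 sin_le1.
Qed.

Lemma packet_bound x t : `|packet x t| <= M * h0 x.
Proof.
apply: mul_cos; rewrite normrM (gtr0_norm (h_pos x)).
by apply: ler_wpM2r; [exact: ltW|case: (g_bound (shift x t))].
Qed.

(** The bound is linear in xi, to be multiplied by a time of order xi^-2. Leibniz' formula bounds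
    [env1], [env2], [env3] by 2 D, 4 D, 8 D. Since xi >= 1, the first two terms give at most (3 * 4
    + 8) xi D and the factor of b gives at most (2 * 2 + 4) xi D. *)
Lemma source_bound x t : `|source x t| <= (20 + 8 * Bm) * M * N * xi * h0 x.
Proof.
have [G0 G1 G2 G3] := g_bound (shift x t); have [H1 H2 H3] := h_bound x.
have hx := h_pos x.
(* As N >= 1, the single constant D bounds every product of a derivative of g and a derivative of h,
   including those with [h0] itself. *)
have H0 : `|h0 x| <= N * h0 x by rewrite gtr0_norm// ler_peMl// ltW.
set D := M * (N * h0 x).
have GH (g h : R) : `|g| <= M -> `|h| <= N * h0 x -> `|g * h| <= D.
  by move=> gM hN; rewrite normrM ler_pM.
have N0 : 0 <= N by exact: le_trans N1.
have D0 : 0 <= D by rewrite mulr_ge0// mulr_ge0// ltW.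
have kGH (k g h : R) : 0 <= k -> `|g| <= M -> `|h| <= N * h0 x ->
    `|k * (g * h)| <= k * D.
  by move=> k0 gM hN; rewrite normrM ger0_norm// ler_wpM2l// GH.
have E1 : `|env1 x t| <= 2 * D.
  apply: le_trans (ler_normD _ _) _.
  by have := GH _ _ G1 H0; have := GH _ _ G0 H1; lra.
have E2 : `|env2 x t| <= 4 * D.
  do 2 ![apply: le_trans (ler_normD _ _) _; rewrite -?lerBrDr].
  have := GH _ _ G2 H0; have := kGH 2 _ _ (ler0n _ _) G1 H1.
  by have := GH _ _ G0 H2; lra.
have E3 : `|env3 x t| <= 8 * D.
  do 3 ![apply: le_trans (ler_normD _ _) _; rewrite -?lerBrDr].
  have := GH _ _ G3 H0; have := kGH 3 _ _ (ler0n _ _) G2 H1.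
  by have := kGH 3 _ _ (ler0n _ _) G1 H2; have := GH _ _ G0 H3; lra.
have Bm0 : 0 <= Bm by exact: le_trans (b_bound x).
have xi0 : 0 <= xi by exact: le_trans xi1.
have S2 : `|- (3 * xi) * (sin (phase x t) * env2 x t)| <= 3 * xi * (4 * D).
  have k0 : 0 <= 3 * xi by rewrite mulr_ge0.
  by rewrite normrM normrN (ger0_norm k0) ler_wpM2l// mul_sin.
have S1 : `|- (2 * xi) * (sin (phase x t) * env1 x t)| <= 2 * xi * (2 * D).
  have k0 : 0 <= 2 * xi by rewrite mulr_ge0.
  by rewrite normrM normrN (ger0_norm k0) ler_wpM2l// mul_sin.
have C3 := mul_cos (phase x t) E3.
have C2 := mul_cos (phase x t) E2.
have S12 : `|b x * (- (2 * xi) * (sin (phase x t) * env1 x t)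
    + cos (phase x t) * env2 x t)| <= Bm * (8 * (xi * D)).
  rewrite normrM ler_pM//; apply: le_trans (ler_normD _ _) _.
  by have : D <= xi * D by [rewrite ler_peMl]; lra.
apply: le_trans (ler_normD _ _) _.
have : `|- (3 * xi) * (sin (phase x t) * env2 x t) + cos (phase x t) * env3 x t|
    <= 20 * (xi * D).
  apply: le_trans (ler_normD _ _) _.
  by have : D <= xi * D by [rewrite ler_peMl]; lra.
rewrite (_ : _ * _ * _ * _ * _ = (20 + 8 * Bm) * (xi * D)); last by rewrite /D; ring.
lra.
Qed.

Lemma packet_supp x t : 1 < `|shift x t| -> packet x t = 0.
Proof. by move=> /g_supp[e0 _ _ _]; rewrite /packet /env0 e0 mul0r mulr0. Qed.

Lemma source_supp x t : 1 < `|shift x t| -> source x t = 0.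
Proof.
move=> /g_supp[e0 e1 e2 e3].
by rewrite /source /env1 /env2 /env3 e0 e1 e2 e3 !(mul0r, mulr0, addr0).
Qed.

End wave_packet.

(** * The growth bound *)

Ltac nonneg :=
  repeat first [done | exact: normr_ge0 | exact: expR_ge0 | exact: ler0n |
    apply: mulr_ge0 | apply: addr_ge0 | by apply: ltW].

Lemma expR_antiderivative_bounded (R : realType) (b B : R -> R) :
  C2_bounded b -> (forall x : R, is_derive x 1 B (b x)) -> L2_estimate b ->
  exists D : R, forall x z : R,
    expR (- 3^-1 * B z) <= D * expR (- 3^-1 * B x).
Proof.
move=> hb dB [A [T [T0 est]]].
have [db cb2 bb] := hb.
have [Bm b_bound] := bb 0%N isT.
have Bm0 : 0 <= Bm by exact: le_trans (b_bound 0).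
have [g0 [g1 [g2 [g3 [M [[dg0 dg1 dg2 cg3] gM g_supp g_half]]]]]] := bump_exists R.
have M0 : 0 <= M by have [+ _ _ _] := gM 0; apply: le_trans.
pose h0 x := expR (- 3^-1 * B x); pose h1 x := - 3^-1 * b x * h0 x.
have [h2 [h3 [N' [dh0 dh1 dh2 ch3 hN']]]] := amplitude_exists hb dB.
pose N := `|N'| + 1.
have N1 : 1 <= N by rewrite lerDr.
have h_pos x : 0 < h0 x by exact: expR_gt0.
have hN x : [/\ `|h1 x| <= N * h0 x, `|h2 x| <= N * h0 x & `|h3 x| <= N * h0 x].
  have N'N : N' * h0 x <= N * h0 x.
    by apply: ler_wpM2r; [exact: ltW|have := ler_norm N'; rewrite /N; lra].
  by have [i1 i2 i3] := hN' x; split; apply: le_trans N'N.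
(* Since B is Lipschitz, the amplitude changes by a bounded factor over a bounded distance, so on
   the support of the bump it is comparable to its value at the centre. *)
have h_growth x y : h0 x <= expR (Bm * `|x - y|) * h0 y.
  rewrite -expRD ler_expR.
  have := lipschitz_of_derivative dB b_bound x y; rewrite distrC.
  have : 0 <= Bm * `|x - y| by rewrite mulr_ge0.
  lra.
pose u al xi x0 := packet g0 h0 xi al x0.
pose F al xi x0 := source b g0 g1 g2 g3 h0 h1 h2 h3 xi al x0.
(* Obtained by solving m <= 2 |A| S for [h0 z], with m and S as below. It depends on neither x0 nor
   z. *)
exists (8 * `|A| * M * expR (3 * Bm)) => x0 z.
rewrite -/(h0 z) -/(h0 x0).
pose L := x0 - z.
have L0 : 0 <= `|L| by [].
(* Bounds the amplitude along the whole path: the centre stays within |L| + 1 of x0 and the bump has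
   radius 1. This grows with |L|, which is harmless, as in the final inequality H enters only
   through C1 / xi. *)
pose H := expR (Bm * (`|L| + 2)) * h0 x0.
have N0 : 0 <= N by lra.
have hz : 0 <= h0 z by exact: ltW.
have hx0 : 0 <= h0 x0 by exact: ltW.
have H0 : 0 <= H by rewrite /H; nonneg.
pose C1 := 2 * (`|L| + 1) * (2 * ((20 + 8 * Bm) * M * N * H)).
have C10 : 0 <= C1 by rewrite /C1; nonneg.
pose m := 2^-1 * (expR (- (2 * Bm)) * h0 z).
have m0 : 0 <= m by rewrite /m; nonneg.
pose S := 2 * (M * (expR Bm * h0 x0)).
have S0 : 0 <= S by rewrite /S; nonneg.
have key xi : 1 <= xi -> (`|L| + 1) / T <= xi -> m <= 2 * (`|A| * (S + C1 / xi)).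
  move=> xi1 xiT.
  have xi0 : 0 < xi by lra.
  have xi20 : 0 < 3 * xi ^+ 2 by rewrite mulr_gt0// exprn_gt0.
  (* The time needed to travel |L| + 1. The extra unit leaves an interval of times at which the
     packet is near z, and the symmetric interval I serves both signs of L. *)
  pose T' := (`|L| + 1) / (3 * xi ^+ 2).
  have T'0 : 0 < T' by rewrite divr_gt0// ltr_wpDl.
  have xixi : xi <= 3 * xi ^+ 2 by rewrite expr2; nra.
  have T'xi : T' <= (`|L| + 1) / xi.
    by rewrite ler_pM2l ?ltr_wpDl// lef_pV2.
  have T'T : T' <= T.
    apply: le_trans T'xi _; rewrite ler_pdivrMr//.
    by move: xiT; rewrite ler_pdivrMr// mulrC.
  pose I := `[- T', T']%classic.
  have I_shift t : I t -> `|3 * xi ^+ 2 * t| <= `|L| + 1.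
    rewrite /I/= in_itv/= -ler_norml => tT.
    rewrite normrM gtr0_norm// mulrC -ler_pdivlMr//.
  have hH t x : I t -> `|x - (x0 - 3 * xi ^+ 2 * t)| <= 1 -> h0 x <= H.
    move=> It xc; apply: le_trans (h_growth x x0) _.
    rewrite /H ler_wpM2r// ler_expR ler_wpM2l//.
    have := I_shift t It.
    have := ler_normD (x - (x0 - 3 * xi ^+ 2 * t)) (- (3 * xi ^+ 2 * t)).
    rewrite normrN (_ : _ - _ + _ = x - x0); last by ring.
    lra.
  have shiftE t x : x - (x0 - 3 * xi ^+ 2 * t) = shift xi x0 x t.
    by rewrite /shift; ring.
  (* K stays free: H serves at every time of I, where only finiteness matters, while at time 0 a
     bound independent of L is needed. *)
  have u_t al t K : 0 <= K ->
      (forall x, `|x - (x0 - 3 * xi ^+ 2 * t)| <= 1 -> h0 x <= K) ->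
      (L2norm (u al xi x0 ^~ t) <= (2 * (M * K))%:E)%E.
    move=> K0 hK; apply: (@L2norm_le _ _ _ (x0 - 3 * xi ^+ 2 * t)).
    + by rewrite mulr_ge0.
    + move=> x; have [xc|xc] := leP `|x - (x0 - 3 * xi ^+ 2 * t)| 1.
        apply: le_trans (packet_bound xi al x0 gM h_pos x t) _.
        by rewrite ler_wpM2l// hK.
      by rewrite /u (packet_supp h0 al g_supp) ?normr0 ?mulr_ge0// -shiftE.
    + move=> x xc; apply: (packet_supp h0 al g_supp).
      by rewrite -shiftE.
  have F_t al t : I t ->
      (L2norm (F al xi x0 ^~ t) <= (2 * ((20 + 8 * Bm) * M * N * xi * H))%:E)%E.
    move=> It.
    have k0 : 0 <= (20 + 8 * Bm) * M * N * xi by nonneg.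
    apply: (@L2norm_le _ _ _ (x0 - 3 * xi ^+ 2 * t)).
    + by rewrite mulr_ge0.
    + move=> x; have [xc|xc] := leP `|x - (x0 - 3 * xi ^+ 2 * t)| 1.
        apply: le_trans (source_bound al x0 gM h_pos hN N1 b_bound xi1 x t) _.
        by rewrite ler_wpM2l// (hH t).
      rewrite /F (source_supp b h0 h1 h2 h3 al g_supp); last by rewrite -shiftE.
      by rewrite normr0 mulr_ge0.
    + move=> x xc; apply: (source_supp b h0 h1 h2 h3 al g_supp).
      by rewrite -shiftE.
  have upper al : (LinftyL2norm I (u al xi x0) <= (`|A| * (S + C1 / xi))%:E)%E.
    have sol : classical_solution b I (F al xi x0) (u al xi x0 ^~ 0) (u al xi x0).
      by apply: packet_solution.
    have lty : (LinftyL2norm I (u al xi x0) < +oo)%E.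
      apply: (@le_lt_trans _ _ (2 * (M * H))%:E); last exact: ltry.
      apply: LinftyL2norm_le; first by nonneg.
      by move=> t It; apply: u_t => // x; exact: hH.
    apply: le_trans (est T' I T'0 T'T (Or33 _ _ erefl) _ _ _ sol lty) _.
    have u0S : (L2norm (u al xi x0 ^~ 0%R) <= S%:E)%E.
      apply: u_t; first by rewrite mulr_ge0 ?expR_ge0// ltW.
      move=> x; rewrite mulr0 subr0 => xx0.
      apply: le_trans (h_growth x x0) _.
      rewrite ler_wpM2r// ler_expR; nra.
    have FC : (L1L2norm I (F al xi x0) <= (C1 / xi)%:E)%E.
      have := L1L2norm_le T'0 (F_t al).
      move=> /le_trans; apply.
      rewrite lee_fin /C1 ler_pdivlMr//.
      set k := (20 + 8 * Bm) * M * N.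
      have k0 : 0 <= k by rewrite /k; nonneg.
      rewrite (_ : _ * xi = (T' * (3 * xi ^+ 2)) * (3^-1 * (4 * (k * H))));
        last by field.
      rewrite /T' divfK ?gt_eqF//.
      have : 0 <= (`|L| + 1) * (k * H) by nonneg.
      lra.
    have FCu0 := leeD u0S FC.
    apply: (@le_trans _ _ (`|A|%:E * (L2norm (u al xi x0 ^~ 0%R) +
        L1L2norm I (F al xi x0)))%E).
      apply: lee_wpmul2r; last by rewrite lee_fin ler_norm.
      apply: adde_ge0; first exact: Lnorm_ge0.
      by apply: integral_ge0 => t _; exact: Lnorm_ge0.
    rewrite EFinM; apply: lee_wpmul2l; first by rewrite lee_fin.
    by rewrite EFinD.
  have ae0 := LinftyL2norm_ae (upper 0).
  have ae1 := LinftyL2norm_ae (upper (- (pi / 2))).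
  (* During these times the centre x0 - 3 xi^2 t lies in [z - 1, z]. *)
  have ab : L / (3 * xi ^+ 2) < (L + 1) / (3 * xi ^+ 2).
    by rewrite ltr_pM2r ?invr_gt0//; lra.
  pose K := (`|A| * (S + C1 / xi))%:E.
  have aeI : {ae @lebesgue_measure R, forall t,
      (I t -> (L2norm (u 0%R xi x0 ^~ t) <= K)%E) /\
      (I t -> (L2norm (u (- (pi / 2))%R xi x0 ^~ t) <= K)%E)}.
    have aeF := ae_filter_ringOfSetsType (@lebesgue_measure R).
    by apply: filterS2 ae0 ae1 => t; split.
  have [t /= tI [u0K u1K]] := ae_itv_exists ab aeI.
  move: tI; rewrite in_itv/= ler_pdivrMr// ler_pdivlMr// => /andP[ta tb].
  have It : I t.
    rewrite /I /= in_itv/= -ler_norml ler_pdivlMr//.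
    rewrite -(gtr0_norm xi20) -normrM ler_norml.
    have := ler_norm L; have := ler_norm (- L); rewrite normrN; lra.
  apply: (L2norm_pair_ge (c := x0 - 3 * xi ^+ 2 * t) _ _ m0 (u0K It) (u1K It)).
  - exact: continuous_packet_x dg0 dh0 _ _ _ _.
  - exact: continuous_packet_x dg0 dh0 _ _ _ _.
  move=> x xc.
  rewrite (_ : u 0 xi x0 x t ^+ 2 + _ = env0 g0 h0 xi x0 x t ^+ 2); last first.
    rewrite /u /packet /phase addr0 addrA cosBpihalf.
    move: (env0 _ _ _ _ _ _) => e.
    by rewrite !exprMn -mulrDl cos2Dsin2 mul1r.
  have e0 : m <= env0 g0 h0 xi x0 x t.
    rewrite /env0; apply: ler_pM => //.
    - by rewrite mulr_ge0 ?expR_ge0// ltW.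
    - by apply: g_half; rewrite -shiftE.
    (* x is within 1/2 of the centre, hence within 3/2 of z, which the factor exp(- 2 Bm) in m
       absorbs. *)
    have := h_growth z x; rewrite -ler_pdivrMl ?expR_gt0// -expRN.
    apply: le_trans; rewrite ler_wpM2r// ler_expR lerN2.
    rewrite mulrC ler_wpM2r// ler_norml.
    move: xc; rewrite ler_norml /L in ta tb *; lra.
  by rewrite lerXn2r// nnegrE//; exact: le_trans e0.
have lim : m <= 2 * (`|A| * S).
  clearbody C1 S.
  apply/ler_addgt0Pr => e e0.
  (* The three summands secure 1 <= xi, T' <= T and 2 |A| C1 / xi <= e respectively. *)
  pose xi := 1 + (`|L| + 1) / T + 2 * `|A| * C1 / e.
  have q1 : 0 <= (`|L| + 1) / T by rewrite divr_ge0 ?ltW// ltr_wpDl.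
  have q2 : 0 <= 2 * `|A| * C1 / e by apply: divr_ge0; [nonneg|exact: ltW].
  have xi1 : 1 <= xi by rewrite /xi; lra.
  have xi2 : (`|L| + 1) / T <= xi by rewrite /xi; lra.
  apply: le_trans (key xi xi1 xi2) _.
  have xi0 : 0 < xi by exact: lt_le_trans xi1.
  rewrite !mulrDr lerD2l !mulrA ler_pdivrMr// -ler_pdivrMl// mulrC /xi.
  lra.
have e2 : 0 < expR (- (2 * Bm)) by exact: expR_gt0.
move: lim; rewrite /m -ler_pdivlMl// mulrC -ler_pdivlMr// => /le_trans; apply.
rewrite -expRN opprK /S (_ : 3 * Bm = 2 * Bm + Bm); last by ring.
rewrite expRD invrK le_eqVlt; apply/orP; left; apply/eqP; ring.
Qed.

Theorem mainTheorem4 (R : realType) (b : R -> R) (hb : C2_bounded b)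
    (hest : L2_estimate b) :
  (ereal_sup [set (integral_from0 p.2.1 (fun s => b (p.1 + p.2.2 * s) * p.2.2))%:E
             | p in [set: R * (R * R)]] < +oo)%E.
Proof.
have cb : continuous b.
  case: hb => db _ _ x; apply/differentiable_continuous/derivable1_diffP.
  exact: (db 0%N).
have [B dB] := antiderivative_exists cb.
have [D BD] := expR_antiderivative_bounded hb dB hest.
apply: (@le_lt_trans _ _ (3 * D)%:E); last exact: ltry.
apply: ge_ereal_sup => _ [[x [t r]] _ <-] /=.
rewrite (integral_from0_antiderivative _ _ _ cb dB) lee_fin.
set y := x + r * t.
(* This reads exp((B y - B x) / 3) <= D, and 1 + v <= exp v then gives B y - B x <= 3 (D - 1). *)
have := BD y x; rewrite -ler_pdivrMr ?expR_gt0// -expRN -expRD.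
have := expR_ge1Dx (- 3^-1 * B x + - (- 3^-1 * B y)).
lra.
Qed.
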